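(* Let $p\ge 1$, $1\le r\le p$, $\epsilon>0$, and let $S\in\mathbb{R}^{p\times p}$ be a symmetric positive semidefinite matrix (a sample covariance matrix) with strictly positive diagonal entries. Consider the problem (P) minimize $\mathcal{L}(\Sigma)=-\log\det(\Sigma^{-1})+\mathrm{tr}(\Sigma^{-1}S)$ subject to $\Sigma=\Psi+LL^\top$, $L\in\mathbb{R}^{p\times r}$, $\Psi=\mathrm{diag}(\psi_1,\dots,\psi_p)\succeq\epsilon I$ (variables $\Psi$, $L$, $\Sigma$), and the problem (Q) minimize $\log\det(\Psi)+\mathrm{tr}(S^* )+\sum_{i=1}^r\big(\log(\max\{1,\lambda_i^*\})-\max\{1,\lambda_i^*\}+1\big)$ subject to $\Psi=\mathrm{diag}(\psi_1,\dots,\psi_p)\succeq\epsilon I$, where $S^*:=\Psi^{-1/2}S\Psi^{-1/2}$ and $\lambda_1^*\ge\lambda_2^*\ge\dots\ge\lambda_p^*$ are the eigenvalues of $S^*$. (a) Problem (P) is equivalent to problem (Q): they have the same optimal value, and a feasible $\Psi$ is a minimizer of (Q) if and only if there is an $L\in\mathbb{R}^{p\times r}$ such that $(\Psi,L)$ is a minimizer of (P). (b) Suppose $\hat\Psi$ is a minimizer of (Q) and $\hat L=\hat\Psi^{1/2}[\hat z_1,\hat z_2,\dots,\hat z_r]$, where $\hat z_1,\dots,\hat z_r$ are eigenvectors of $\hat\Psi^{-1/2}S\hat\Psi^{-1/2}$ corresponding to its top $r$ eigenvalues $\hat\lambda_i^*$, $i\le r$, with $\|\hat z_i\|^2=\max\{1,\hat\lambda_i^*\}-1$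 for all $i=1,\dots,r$ (so $\hat z_i$ is the zero vector when $\hat\lambda_i^*\le 1$). Then $(\hat\Psi,\hat L)$ is a minimizer of (P).
   Context: $A\succeq B$ means that $A-B$ is positive semidefinite. For a positive definite matrix $A$, $A^{1/2}$ is its symmetric square root and $A^{-1/2}$ the symmetric square root of $A^{-1}$. $\|\cdot\|$ is the Euclidean norm.
   Formalization: In (b) the eigenvectors chosen for a repeated eigenvalue are additionally required to be mutually orthogonal; without this (b) fails, e.g. p=r=2, S=I, ε=1/2, Ψ=I/2, z_1=z_2 a unit vector. *)

(* Defs.v *)
From HB Require Import structures.
From mathcomp Require Import all_boot all_order all_algebra.
From mathcomp Require Import all_classical all_reals all_analysis.

Set Implicit Arguments.
Unset Strict Implicit.
Unset Printing Implicit Defensive.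

Import Order.TTheory GRing.Theory Num.Theory.
Local Open Scope classical_set_scope.
Local Open Scope ring_scope.

Section Matrices.
Context {R : realType}.

Definition psdmx n (A : 'M[R]_n) : Prop :=
  A^T = A /\ forall x : 'cV[R]_n, 0 <= (x^T *m A *m x) 0 0.

(* A >= B in the Loewner order *)
Definition lownerge n (A B : 'M[R]_n) : Prop := psdmx (A - B).

(* The unique positive semidefinite square root of a positive semidefinite A
   (0 if A is not positive semidefinite). *)
Definition sqrtmx n (A : 'M[R]_n) : 'M[R]_n :=
  xget 0 [set B | psdmx B /\ B *m B = A].

(* The eigenvalues of A in nonincreasing order, repeated according to their
   multiplicity; nil if char_poly A does not split over R, which never happens
   for a symmetric A. *)
Definition eigvals n (A : 'M[R]_n) : seq R :=
  xget [::] [set s | sorted >=%R s /\ char_poly A = \prod_(a <- s) ('X - a%:P)].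

(* Numbered from 0, so eigval A i is the (i+1)-st largest eigenvalue. *)
Definition eigval n (A : 'M[R]_n) (i : nat) : R := nth 0 (eigvals A) i.

(* The norm `|z| of the library is the sup norm on matrices. *)
Definition enorm n (z : 'cV[R]_n) : R := Num.sqrt (\sum_i z i 0 ^+ 2).

(* The columns of Z are eigenvectors, possibly zero, for the r largest
   eigenvalues of A. The eigenvectors chosen for a repeated eigenvalue are
   mutually orthogonal; for a symmetric A and distinct eigenvalues
   orthogonality is automatic. *)
Definition top_eigenvectors n r (A : 'M[R]_n) (Z : 'M[R]_(n, r)) : Prop :=
  (forall i : 'I_r, A *m col i Z = eigval A i *: col i Z) /\
  (forall i j : 'I_r, i != j -> eigval A i = eigval A j ->
     ((col i Z)^T *m col j Z) 0 0 = 0).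

End Matrices.

Section Optimization.
Context {R : realType}.

Definition is_minimizer (T : Type) (feas : set T) (f : T -> R) (x : T) : Prop :=
  feas x /\ forall y, feas y -> f x <= f y.

Definition optimal_value (T : Type) (feas : set T) (f : T -> R) : \bar R :=
  ereal_inf [set (f x)%:E | x in feas].

End Optimization.

Section FactorAnalysis.
Context {R : realType}.
Variables (p r : nat) (eps : R) (S : 'M[R]_p).

Definition diag_feasible : set 'M[R]_p :=
  [set Psi | is_diag_mx Psi /\ lownerge Psi eps%:M].

(* Suffix P: the likelihood problem, over triples (Psi, L, Sigma).
   Suffix Q: its reduction to a problem in the diagonal matrix Psi alone. *)
Definition feasP : set ('M[R]_p * 'M[R]_(p, r) * 'M[R]_p) :=
  [set v | let: (Psi, L, Sigma) := v in
           diag_feasible Psi /\ Sigma = Psi + L *m L^T].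

Definition negloglik (Sigma : 'M[R]_p) : R :=
  - ln (\det (invmx Sigma)) + \tr (invmx Sigma *m S).

Definition objP (v : 'M[R]_p * 'M[R]_(p, r) * 'M[R]_p) : R := negloglik v.2.

(* The third variable, Sigma, is determined by (Psi, L). *)
Definition minimizerP (Psi : 'M[R]_p) (L : 'M[R]_(p, r)) : Prop :=
  is_minimizer feasP objP (Psi, L, Psi + L *m L^T).

(* S^* = Psi^(-1/2) S Psi^(-1/2) *)
Definition Sstar (Psi : 'M[R]_p) : 'M[R]_p :=
  sqrtmx (invmx Psi) *m S *m sqrtmx (invmx Psi).

Definition objQ (Psi : 'M[R]_p) : R :=
  ln (\det Psi) + \tr (Sstar Psi) +
  \sum_(i < r) (ln (Num.max 1 (eigval (Sstar Psi) i))
                - Num.max 1 (eigval (Sstar Psi) i) + 1).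

Definition minimizerQ (Psi : 'M[R]_p) : Prop :=
  is_minimizer diag_feasible objQ Psi.

End FactorAnalysis.

(* Main.v *)
Require Import Defs.
From HB Require Import structures.
From mathcomp Require Import all_boot all_order all_algebra.
From mathcomp Require Import all_classical all_reals all_analysis.
From mathcomp Require Import perm complex ring lra.
Import Order.TTheory GRing.Theory Num.Theory.
Local Open Scope classical_set_scope.
Local Open Scope ring_scope.

(** For a feasible [Psi], write [Sigma = Psi^(1/2) B Psi^(1/2)] with
    [B = 1 + M M^T], so that [L(Sigma) = ln det Psi + ln det B + tr (B^-1 A)],
    where [A = Sstar S Psi]; it remains to minimize over [M] for [Psi] fixed.
    Let [b_j], [q_j] be the eigenpairs of [B] (all [b_j >= 1], at most [r] of
    them different from 1), [l_k], [u_k] those of [A], and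
    [w_jk = <q_j, u_k>^2], a doubly stochastic matrix.  The last two terms equal
    [\sum_jk w_jk (ln b_j + l_k / b_j)], which splits into scalar problems:
    [ln b + l / b >= l + gain l] for [b >= 1].  Only the [j] with [b_j != 1]
    contribute a gain, and they carry total weight at most [r] and weight at
    most 1 on each [l_k], so the best case puts all of it on the [r] largest
    eigenvalues.  Scaled top eigenvectors reach this bound, by the Woodbury
    and Sylvester identities. *)

(** * Spectral theorem for real symmetric matrices *)

(** Over the algebraically closed [R[i]] there is an eigenpair [a], [v]. Symmetry makes [a] real:
    evaluating [v A w] from either side, with [w] the conjugate transpose of [v], gives both
    [a (v w)] and [a^* (v w)]. Being a root of the real characteristic polynomial, [a] also has a
    real eigenvector. *)
Lemma symmetric_eigenvector {R : rcfType} n (A : 'M[R]_n.+1) :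
  A^T = A -> exists a (v : 'rV[R]_n.+1), v != 0 /\ v *m A = a *: v.
Proof.
move=> symA; pose f := real_complex R.
have [a /eigenvalueP [v vA nz_v]] := eigenvalue_closed (map_mx f A) (ltn0Sn n).
have a_real : a^* = a.
  pose w := (map_mx Num.conj v)^T.
  have vvN0 : (v *m w) 0 0 != 0.
    rewrite mxE psumr_neq0; last by move=> i _; rewrite !mxE mul_conjC_ge0.
    have [j nz_vj] : exists j, v 0 j != 0.
      by apply/existsP; apply: contraNT nz_v; rewrite negb_exists => /forallP v0;
         apply/eqP/rowP => j; rewrite mxE; apply/eqP; have:= v0 j; rewrite negbK.
    by apply/hasP; exists j; rewrite ?mem_index_enum //= !mxE mul_conjC_gt0.
  have Aw : map_mx f A *m w = a^* *: w.
    rewrite -[LHS]trmxK trmx_mul trmxK map_trmx symA.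
    rewrite -[RHS]trmxK linearZ /= trmxK -map_mxZ /= -vA map_mxM /=.
    congr ((_ *m _)^T); apply/matrixP => i j; rewrite !mxE.
    exact: esym (conjc_real _).
  apply: (mulIf vvN0); have := mulmxA v (map_mx f A) w.
  by rewrite vA Aw -scalemxAl -scalemxAr => /matrixP /(_ 0 0); rewrite !mxE.
have [x ax] : exists x, a = f x.
  by exists (complex.Re a); case: a a_real {vA} => x y /eqP; rewrite eq_complex /= => /andP [_ /eqP];
     rewrite /f /= => yE; congr (_ +i* _)%C; lra.
have /eigenvalueP [u uA nz_u] : eigenvalue A x.
  rewrite eigenvalue_root_char -(fmorph_root f) map_char_poly -eigenvalue_root_char.
  suff : eigenvalue (map_mx f A) a by rewrite ax.
  by apply/eigenvalueP; exists v.
by exists x, u.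
Qed.

Lemma mulmx_tr_ge0 {R : realDomainType} n (v : 'rV[R]_n) : 0 <= (v *m v^T) 0 0.
Proof. by rewrite mxE sumr_ge0 // => i _; rewrite mxE -expr2 sqr_ge0. Qed.

Lemma mulmx_tr_eq0 {R : realDomainType} n (v : 'rV[R]_n) :
  ((v *m v^T) 0 0 == 0) = (v == 0).
Proof.
rewrite mxE psumr_eq0; last by move=> i _; rewrite mxE -expr2 sqr_ge0.
apply/allP/eqP => [v0 | -> i _]; last by rewrite !mxE mul0r eqxx.
apply/rowP => i; have := v0 i (mem_index_enum i).
by rewrite !mxE -expr2 sqrf_eq0 => /eqP.
Qed.

(** The reflection along [w = v - u] exchanges two distinct unit vectors. *)
Lemma householder {R : realFieldType} n (u v : 'rV[R]_n) :
  u *m u^T = 1%:M -> v *m v^T = 1%:M ->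
  exists H : 'M[R]_n, [/\ H^T = H, H *m H = 1%:M & u *m H = v].
Proof.
move=> uu vv; have [-> | neq_uv] := eqVneq u v.
  by exists 1%:M; rewrite trmx1 !mulmx1.
pose w := v - u; pose c : R := (w *m w^T) 0 0.
have c_neq0 : c != 0 by rewrite mulmx_tr_eq0 subr_eq0 eq_sym.
have ww : w *m w^T = c%:M by rewrite [LHS]mx11_scalar.
(* Since [u] and [v] have norm 1, [c = 2 - 2 <u, v> = - 2 <u, w>]; hence the reflection takes [u] to
   [u + w]. *)
have uw : (2%:R / c) *: (u *m w^T) = (- 1)%:M.
  rewrite [u *m _]mx11_scalar scale_scalar_mx; congr _%:M.
  have cE : c = - 2%:R * (u *m w^T) 0 0.
    have vu : v *m u^T = u *m v^T.
      by rewrite -[LHS]trmxK trmx_mul trmxK [u *m _]mx11_scalar tr_scalar_mx.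
    rewrite /c /w linearB /= mulmxBl !mulmxBr vu uu vv.
    by rewrite !mxE eqxx /=; ring.
  have : u *m w^T != 0.
    apply/eqP => uw0; move: c_neq0; by rewrite cE uw0 mxE mulr0 eqxx.
  rewrite cE => nz; field.
  apply: contra_neq nz => nz; by apply/matrixP => i j; rewrite !ord1 nz mxE.
have -> : v = u + w by rewrite addrC subrK.
clearbody c; clearbody w.
exists (1%:M - (2%:R / c) *: (w^T *m w)); split.
- by rewrite linearB /= linearZ /= trmx_mul trmxK trmx1.
- rewrite mulmxBl mul1mx mulmxBr mulmx1 -!scalemxAl -!scalemxAr.
  rewrite !mulmxA -(mulmxA w^T) ww mul_mx_scalar -!scalemxAl !scalerA.
  rewrite -[RHS]subr0 -addrA -opprD; congr (_ - _).
  rewrite addrA -scalerDl -scalerBl -[RHS](scale0r (w^T *m w)); congr (_ *: _).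
  by field.
- rewrite mulmxBr mulmx1 -scalemxAr mulmxA scalemxAl uw mul_scalar_mx.
  by rewrite scaleN1r opprK.
Qed.

Lemma unit_symmetric_eigenvector {R : rcfType} n (A : 'M[R]_n.+1) :
  A^T = A -> exists a (v : 'rV[R]_n.+1), v *m v^T = 1%:M /\ v *m A = a *: v.
Proof.
move=> /symmetric_eigenvector [a [v [nz_v vA]]].
pose c := (v *m v^T) 0 0.
have c_gt0 : 0 < c by rewrite lt_neqAle mulmx_tr_ge0 andbT eq_sym mulmx_tr_eq0.
exists a, ((Num.sqrt c)^-1 *: v); split; last first.
  by rewrite -scalemxAl vA !scalerA mulrC.
rewrite linearZ /= -scalemxAl -scalemxAr scalerA [v *m _]mx11_scalar -/c.
rewrite scale_scalar_mx -invfM -expr2 sqr_sqrtr ?ltW // mulVf //.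
by rewrite gt_eqF.
Qed.

(** Deflation: a reflection [H] carries the first basis vector to a unit eigenvector of [A], so
    [H A H] splits off a block of size 1, and the induction hypothesis diagonalizes the other
    block. *)
Theorem symmetric_spectral {R : rcfType} n (A : 'M[R]_n) :
  A^T = A -> exists (Q : 'M[R]_n) (d : 'rV[R]_n),
    Q^T *m Q = 1%:M /\ A = Q *m diag_mx d *m Q^T.
Proof.
elim: n A => [|n IHn] A symA.
  by exists 1%:M, 0; split; apply/matrixP; case.
have [a [v [vv vA]]] := unit_symmetric_eigenvector n A symA.
pose e : 'rV[R]_n.+1 := delta_mx 0 0.
have ee : e *m e^T = 1%:M.
  by rewrite trmx_delta mul_delta_mx; apply/matrixP => i j; rewrite !ord1 !mxE.
have [H [symH HH eH]] := householder _ e v ee vv.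
pose B : 'M[R]_(1 + n) := H *m A *m H.
have symB : B^T = B by rewrite /B !trmx_mul symH symA mulmxA.
have eB : e *m B = a *: e.
  by rewrite /B !mulmxA eH vA -scalemxAl -eH -mulmxA HH mulmx1.
have AE : A = H *m B *m H.
  by rewrite /B !mulmxA HH mul1mx -mulmxA HH mulmx1.
clearbody B.
(* The first row of [B] is [a e]; by symmetry so is the first column, which makes [B] block
   diagonal. *)
have Brow j : B 0 j = a *+ (j == 0).
  have /matrixP /(_ 0 j) := eB; rewrite -rowE !mxE eqxx /= => ->.
  by rewrite mulr_natr.
have Bl (i : 'I_1) j : B (lshift n i) j = a *+ (j == lshift n 0).
  by rewrite ord1 (_ : lshift n 0 = 0 :> 'I_(1 + n)) ?Brow //; apply: val_inj.
have [Q [d [QQ CE]]] : exists (Q : 'M[R]_n) (d : 'rV[R]_n),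
    Q^T *m Q = 1%:M /\ drsubmx B = Q *m diag_mx d *m Q^T.
  by apply: IHn; rewrite trmx_drsub symB.
have BE : B = block_mx a%:M 0 0 (drsubmx B).
  rewrite -[LHS]submxK; congr block_mx.
  - by apply/matrixP => i j; rewrite !ord1 !mxE Bl eqxx.
  - by apply/matrixP => i j; rewrite !mxE Bl -val_eqE.
  - by apply/matrixP => i j; rewrite -symB !mxE Bl -val_eqE.
pose G : 'M[R]_(1 + n) := block_mx 1%:M 0 0 Q.
pose f : 'rV[R]_(1 + n) := row_mx a%:M d.
have GG : G^T *m G = 1%:M.
  rewrite tr_block_mx mulmx_block !trmx0 trmx1 !mulmx0 !mul0mx !addr0 !add0r.
  by rewrite mulmx1 QQ -scalar_mx_block.
have BG : B = G *m diag_mx f *m G^T.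
  rewrite BE CE diag_mx_row tr_block_mx !mulmx_block.
  rewrite !trmx0 trmx1 !mulmx0 !mul0mx !addr0 !add0r mulmx1 mul1mx.
  congr block_mx; rewrite ?mul0mx //.
  by apply/matrixP => i j; rewrite !ord1 !mxE.
exists (H *m G), f; split.
  by rewrite trmx_mul -mulmxA (mulmxA H^T) symH HH mul1mx.
by rewrite AE BG trmx_mul symH !mulmxA.
Qed.

Lemma char_poly_similar {R : comUnitRingType} n (P Q A : 'M[R]_n) :
  P *m Q = 1%:M -> char_poly (Q *m A *m P) = char_poly A.
Proof.
move=> PQ; have QP : Q *m P = 1%:M by apply: mulmx1C.
rewrite /char_poly /char_poly_mx.
have -> : 'X%:M - map_mx polyC (Q *m A *m P) =
    map_mx polyC Q *m ('X%:M - map_mx polyC A) *m map_mx polyC P.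
  rewrite mulmxBr mulmxBl -!map_mxM; congr (_ - _).
  by rewrite scalar_mxC -mulmxA -map_mxM QP map_mx1 mulmx1.
by rewrite !det_mulmx mulrAC -det_mulmx -map_mxM QP map_mx1 det1 mul1r.
Qed.

(** Links [eigvals], defined through the characteristic polynomial, to an orthonormal eigenbasis:
    two factorizations into monic linear factors differ by a permutation, which is then applied to
    the columns of [Q]. *)
Lemma eigvalsP {R : realType} n (A : 'M[R]_n) : A^T = A ->
  [/\ sorted >=%R (eigvals A), size (eigvals A) = n &
    exists2 Q : 'M[R]_n, Q^T *m Q = 1%:M &
      A = Q *m diag_mx (\row_i eigval A i) *m Q^T].
Proof.
move=> symA; have [Q [d [QQ AE]]] := symmetric_spectral _ _ symA.
pose s := [seq d 0 i | i <- enum 'I_n].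
have charE : char_poly A = \prod_(a <- s) ('X - a%:P).
  rewrite AE (@char_poly_similar _ _ Q^T Q _ QQ) char_poly_trig ?diag_mx_is_trig //.
  rewrite big_map big_enum /=; apply: eq_bigr => i _.
  by rewrite mxE eqxx mulr1n.
have [sorted_eig charE'] : sorted >=%R (eigvals A) /\
    char_poly A = \prod_(a <- eigvals A) ('X - a%:P).
  (* Sorting the diagonal [d] yields a member of the set, so [xget] does not fall back on its
     default [[::]]. *)
  apply: (@xgetPex _ _ [set s | sorted >=%R s /\ char_poly A = \prod_(a <- s) ('X - a%:P)]).
  exists (sort >=%R s) => /=; split; first by apply: sort_sorted => x y; apply: ge_total.
  by rewrite charE; apply: perm_big; rewrite perm_sym perm_sort.
have /tuple_permP [σ sE] : perm_eq (eigvals A) [tuple d 0 i | i < n].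
  apply: prod_XsubC_eq.
  by rewrite -charE' charE; congr bigop; rewrite /s /= enumT.
have eigE (i : 'I_n) : eigval A i = d 0 (σ i).
  rewrite /eigval sE -tnth_nth.
  by rewrite !tnth_mktuple.
split=> //; first by rewrite sE size_tuple.
exists (col_perm σ Q).
  apply/matrixP => i j; move/matrixP: QQ => /(_ (σ i) (σ j)).
  rewrite !mxE (inj_eq perm_inj) => <-; apply: eq_bigr => k _.
  by rewrite !mxE.
rewrite {1}AE; apply/matrixP => i j.
rewrite !mul_mx_diag !mxE (reindex_inj (@perm_inj _ σ)) /=.
by apply: eq_bigr => k _; rewrite !mxE -eigE.
Qed.

(** * The scalar problem *)

(* [l + gain l] is the minimum of [ln b + l / b] over [b >= 1], reached at
   [b = max 1 l]. *)
Definition gain {R : realType} (l : R) : R := ln (Num.max 1 l) - Num.max 1 l + 1.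

Lemma ln_le_subr1 {R : realType} (x : R) : 0 < x -> ln x <= x - 1.
Proof.
by move=> x0; have := @le_ln1Dx R (x - 1); rewrite addrCA subrr addr0; apply; lra.
Qed.

Lemma ler_ln_sub {R : realType} (x y : R) :
  1 <= x -> x <= y -> ln y - ln x <= y - x.
Proof.
move=> x1 xy; have x0 : 0 < x by lra.
rewrite -ln_div ?posrE //; last by lra.
apply: le_trans (ln_le_subr1 _ _) _; first by apply: divr_gt0; lra.
rewrite -[X in _ - X](divff (lt0r_neq0 x0)) -mulrBl ler_pdivrMr //.
by rewrite ler_peMr //; lra.
Qed.

Lemma gain_antitone {R : realType} (l m : R) : l <= m -> gain m <= gain l.
Proof.
move=> lm; rewrite /gain.
have := @ler_ln_sub _ (Num.max 1 l) (Num.max 1 m).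
rewrite le_max lexx /= => /(_ isT).
by rewrite ge_max !le_max lexx /= lm orbT => /(_ isT); lra.
Qed.

Lemma gain_le0 {R : realType} (l : R) : gain l <= 0.
Proof.
have := @ln_le_subr1 _ (Num.max 1 l); rewrite lt_max ltr01 /= => /(_ isT).
by rewrite /gain; lra.
Qed.

(** Both cases rest on [ln x <= x - 1]. For [l <= 1] the gain is 0 and [x = 1 / b] leaves the term
    [(1 - l) (1 - 1 / b) >= 0]; for [l > 1] take [x = l / b]. *)
Lemma gain_bound {R : realType} (l b : R) : 1 <= b -> l + gain l <= ln b + l / b.
Proof.
move=> b1; have b0 : 0 < b by lra.
rewrite /gain; have [l1|l1] := leP l 1.
  rewrite ln1.
  have := ln_le_subr1 b^-1; rewrite invr_gt0 lnV ?posrE // => /(_ b0).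
  have: (1 - l) * (1 - b^-1) >= 0 by rewrite mulr_ge0 ?subr_ge0 // invf_le1.
  by lra.
have l0 : 0 < l by lra.
have := ln_le_subr1 (l / b); rewrite divr_gt0 // ln_div ?posrE //.
by move=> /(_ isT); lra.
Qed.

Lemma ln_prod {R : realType} (I : finType) (f : I -> R) :
  (forall i, 0 < f i) -> ln (\prod_i f i) = \sum_i ln (f i).
Proof.
move=> f0; suff [] : ln (\prod_i f i) = \sum_i ln (f i) /\ 0 < \prod_i f i by [].
elim/big_rec2: _ => [|i x y _ [<- y0]]; first by rewrite ln1.
by rewrite lnM ?posrE ?mulr_gt0.
Qed.

(** * Weighted sums, ranks and matrix identities *)

(** Subtract the threshold [c], the last of the first [r] values. Then [g i - c] is nonpositive for
    [i < r] and nonnegative afterwards, so weights 1 and then 0 are best term by term; the remainder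
    compares [c * r] with [c] times the total weight, where [c <= 0]. *)
Lemma sum_top_le_weighted {R : realFieldType} (p r : nat) (g : nat -> R) (w : 'I_p -> R) :
  (0 < r <= p)%N -> (forall i, g i <= 0) ->
  (forall i j, (i <= j < p)%N -> g i <= g j) ->
  (forall i, 0 <= w i <= 1) -> \sum_i w i <= r%:R ->
  \sum_(i < r) g i <= \sum_i w i * g i.
Proof.
move=> /andP [r0 rp] g0 gmono w01 wr; pose c := g r.-1.
have -> : \sum_(i < r) g i = \sum_(i < p) (if (i < r)%N then g i - c else 0) + c * r%:R.
  rewrite -big_mkcond -(big_ord_widen p (fun i => g i - c) rp) /=.
  by rewrite sumrB sumr_const card_ord -[c *+ r]mulr_natr subrK.
have -> : \sum_i w i * g i = \sum_i w i * (g i - c) + c * \sum_i w i.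
  by rewrite mulr_sumr -big_split; apply: eq_bigr => i _ /=; ring.
apply: lerD; last by rewrite ler_wnM2l // g0.
apply: ler_sum => i _; have /andP [wi0 wi1] := w01 i.
case: ltnP => ir.
  have : g i <= c.
    by apply: gmono; rewrite prednK // rp andbT -ltnS prednK.
  by move=> gc; rewrite ler_niMl // subr_le0.
rewrite mulr_ge0 // subr_ge0 gmono // ltn_ord andbT.
by rewrite (leq_trans _ ir) ?leq_pred.
Qed.

(** The principal submatrix on the nonzero diagonal entries is invertible, yet it factors through
    dimension [r]. *)
Lemma card_diag_le_rank {F : fieldType} n r (d : 'rV[F]_n)
    (M : 'M[F]_(n, r)) (N : 'M[F]_(r, n)) :
  diag_mx d = M *m N -> (#|[pred j | d ord0 j != 0%R]| <= r)%N.
Proof.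
set J := [pred j | _] => dE.
pose f (i : 'I_#|J|) : 'I_n := enum_val i.
have unitD : mxsub f f (diag_mx d) \in unitmx.
  have -> : mxsub f f (diag_mx d) = diag_mx (\row_i d 0 (f i)).
    by apply/matrixP => i j; rewrite !mxE (inj_eq enum_val_inj).
  rewrite unitmxE det_diag unitfE prodf_seq_neq0; apply/allP => i _ /=.
  by rewrite mxE; have := enum_valP i; rewrite inE.
rewrite -(mxrank_unit unitD) dE.
have -> : mxsub f f (M *m N) = rowsub f M *m colsub f N.
  by apply/matrixP => i j; rewrite !mxE; apply: eq_bigr => k _; rewrite !mxE.
exact: leq_trans (mxrankM_maxl _ _) (rank_leq_col _).
Qed.

Lemma invmx_uniq {F : comUnitRingType} n (A B : 'M[F]_n) : A *m B = 1%:M -> invmx A = B.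
Proof. by move=> AB; have [uA _] := mulmx1_unit AB; rewrite -[LHS]mulmx1 -AB mulKmx. Qed.

Lemma diag_mx_inv {F : fieldType} n (d : 'rV[F]_n) : (forall i, d 0 i != 0) ->
  diag_mx d *m diag_mx (\row_i (d 0 i)^-1) = 1%:M.
Proof.
move=> d0; rewrite mulmx_diag -diag_const_mx; congr diag_mx.
by apply/rowP => i; rewrite !mxE divff.
Qed.

(** Sylvester's identity: multiplying [K] by the unimodular [P] on the left or on the right clears
    the lower left block, leaving one of the two determinants each time. *)
Lemma det_1DmulC {F : comNzRingType} m n (X : 'M[F]_(m, n)) (Y : 'M[F]_(n, m)) :
  \det (1%:M + X *m Y) = \det (1%:M + Y *m X).
Proof.
pose K := block_mx 1%:M (- Y) X 1%:M.
pose P : 'M[F]_(n + m) := block_mx 1%:M 0 (- X) 1%:M.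
have detP : \det P = 1 by rewrite det_lblock !det1 mulr1.
have <-: \det (P *m K) = \det (1%:M + X *m Y).
  rewrite mulmx_block !mul1mx !mul0mx !mulmx1 mulmxN mulNmx !addr0 opprK addNr.
  by rewrite det_ublock det1 mul1r addrC.
have <-: \det (K *m P) = \det (1%:M + Y *m X).
  rewrite mulmx_block !mul1mx !mulmx0 !mulmx1 mulmxN mulNmx opprK !add0r addrN.
  by rewrite det_ublock det1 mulr1.
by rewrite !det_mulmx mulrC.
Qed.

Lemma mxtrace_orthogonal {R : comNzRingType} n (Q A : 'M[R]_n) :
  Q^T *m Q = 1%:M -> \tr (Q^T *m A *m Q) = \tr A.
Proof. by move=> QQ; rewrite mxtrace_mulC mulmxA (mulmx1C QQ) mul1mx. Qed.

Lemma mxtrace_diag_mul {R : pzSemiRingType} n (d : 'rV[R]_n) (A : 'M[R]_n) :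
  \tr (diag_mx d *m A) = \sum_i d 0 i * A i i.
Proof. by apply: eq_bigr => i _; rewrite mul_diag_mx mxE. Qed.

Lemma conj_diagE {R : comNzRingType} n (V : 'M[R]_n) (d : 'rV[R]_n) i :
  (V *m diag_mx d *m V^T) i i = \sum_k V i k ^+ 2 * d 0 k.
Proof.
by rewrite mxE; apply: eq_bigr => k _; rewrite mul_mx_diag !mxE mulrAC -expr2.
Qed.

Lemma orthogonal_row_norm {R : comNzRingType} n (V : 'M[R]_n) i :
  V *m V^T = 1%:M -> \sum_k V i k ^+ 2 = 1.
Proof.
move=> /matrixP /(_ i i); rewrite !mxE eqxx mulr1n => <-.
by apply: eq_bigr => k _; rewrite mxE -expr2.
Qed.

(** * The bound over matrices [1 + M M^T], and its attainment *)

Section Likelihood.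
Context {R : realType}.

Lemma eigval_mono n (A : 'M[R]_n) i j : A^T = A ->
  (i <= j < n)%N -> eigval A j <= eigval A i.
Proof.
move=> symA /andP [ij jn]; have [eig_sorted eig_size _] := eigvalsP _ _ symA.
have ge_trans : transitive (>=%R : rel R) by move=> x y z yx zx; apply: le_trans zx yx.
apply: (sorted_leq_nth ge_trans _ 0 eig_sorted) => //; first exact: lexx.
  by rewrite inE eig_size (leq_ltn_trans ij).
by rewrite inE eig_size.
Qed.

(** The positivity of [\det B] is part of the conclusion because it is what later allows the
    logarithm of the determinant of [Sigma] to be split. *)
Lemma low_rank_loglik_ge p r (A : 'M[R]_p) (M : 'M[R]_(p, r)) :
  A^T = A -> (0 < r <= p)%N ->
  let B := 1%:M + M *m M^T in
  0 < \det B /\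
  \tr A + \sum_(i < r) gain (eigval A i) <= ln (\det B) + \tr (invmx B *m A).
Proof.
move=> symA rp B.
have symB : B^T = B by rewrite linearD /= trmx1 trmx_mul trmxK.
have [Q [b [QQ BE]]] := symmetric_spectral _ _ symB.
have QQ' := mulmx1C QQ.
have [_ _ [U UU AE]] := eigvalsP _ _ symA.
have UU' := mulmx1C UU.
pose l i := eigval A i.
pose N := Q^T *m M.
(* In the eigenbasis of [B], [b_j - 1] is the squared norm of row [j] of [N], hence [b_j >= 1]; the
   factor [N] also bounds the number of [b_j] other than 1. *)
have bE : diag_mx b = 1%:M + N *m N^T.
  have <- : Q^T *m B *m Q = diag_mx b.
    by rewrite BE !mulmxA QQ mul1mx -mulmxA QQ mulmx1.
  by rewrite /B mulmxDr mulmxDl mulmx1 QQ /N trmx_mul trmxK !mulmxA.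
have b_ge1 i : 1 <= b 0 i.
  have /matrixP /(_ i i) := bE; rewrite !mxE eqxx !mulr1n => ->.
  by rewrite lerDl sumr_ge0 // => k _; rewrite !mxE -expr2 sqr_ge0.
have b_gt0 i : 0 < b 0 i by apply: lt_le_trans (b_ge1 i).
have detB : \det B = \prod_i b 0 i.
  by rewrite BE !det_mulmx mulrAC -det_mulmx QQ' det1 mul1r det_diag.
have det_gt0 : 0 < \det B by rewrite detB prodr_gt0.
split=> //.
have invB : invmx B = Q *m diag_mx (\row_i (b 0 i)^-1) *m Q^T.
  apply: invmx_uniq; rewrite {1}BE !mulmxA -(mulmxA _ Q^T Q) QQ mulmx1.
  rewrite -(mulmxA Q (diag_mx b)) diag_mx_inv ?mulmx1 // => i.
  by rewrite gt_eqF.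
pose V := Q^T *m U.
have VV : V *m V^T = 1%:M.
  by rewrite /V trmx_mul trmxK mulmxA -(mulmxA _ U) UU' mulmx1 QQ.
have VV' : V^T *m V^T^T = 1%:M by rewrite trmxK; apply: mulmx1C.
have QAQ : Q^T *m A *m Q = V *m diag_mx (\row_i l i) *m V^T.
  by rewrite AE /V trmx_mul trmxK !mulmxA.
clearbody V.
pose w j k := V j k ^+ 2.
have w_row j : \sum_k w j k = 1 by apply: orthogonal_row_norm.
have w_col k : \sum_j w j k = 1.
  rewrite -(orthogonal_row_norm _ V^T k VV').
  by apply: eq_bigr => j _; rewrite mxE.
have w_ge0 j k : 0 <= w j k by rewrite sqr_ge0.
have trA : \tr A = \sum_j \sum_k w j k * l k.
  rewrite -(mxtrace_orthogonal _ Q A QQ) QAQ; apply: eq_bigr => j _.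
  by rewrite conj_diagE; apply: eq_bigr => k _; rewrite mxE.
have trBA : \tr (invmx B *m A) = \sum_j \sum_k w j k * (l k / b 0 j).
  rewrite invB -!mulmxA mxtrace_mulC -!mulmxA (mulmxA Q^T) QAQ mxtrace_diag_mul.
  apply: eq_bigr => j _; rewrite conj_diagE mxE mulr_sumr.
  by apply: eq_bigr => k _; rewrite mxE mulrC -mulrA.
pose J := [pred j | b 0 j - 1 != 0].
have cardJ : (#|J| <= r)%N.
  have : diag_mx (b - const_mx 1) = N *m N^T.
    by rewrite linearB /= bE diag_const_mx addrC addKr.
  move=> /card_diag_le_rank; congr (_ <= _)%N.
  by apply: eq_card => j; rewrite !inE !mxE.
(* The weight that the nontrivial eigenvalues of [B] put on [l k]: column sums bound each [v k] by
   1, row sums bound the total by [#|J|], hence by [r]. *)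
pose v k := \sum_(j in J) w j k.
have top : \sum_(i < r) gain (l i) <= \sum_k v k * gain (l k).
  apply: (sum_top_le_weighted _ _ (fun i => gain (l i)) v rp).
  - by move=> i; apply: gain_le0.
  - by move=> i j ij; apply: gain_antitone; apply: eigval_mono.
  - move=> k; rewrite sumr_ge0 //= -(w_col k) [leRHS](bigID [in J]) /=.
    by rewrite lerDl sumr_ge0.
  - rewrite exchange_big /= (eq_bigr (fun=> 1)); last by move=> j _; apply: w_row.
    by rewrite sumr_const ler_nat.
apply: (@le_trans _ _ (\tr A + \sum_k v k * gain (l k))); first by rewrite lerD2l.
have -> : \sum_k v k * gain (l k) = \sum_j \sum_k w j k * (if j \in J then gain (l k) else 0).
  rewrite exchange_big /=; apply: eq_bigr => k _.
  rewrite /v mulr_suml big_mkcond /=; apply: eq_bigr => j _.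
  by case: ifP; rewrite ?mulr0.
rewrite trA trBA detB ln_prod // -!big_split; apply: ler_sum => j _ /=.
(* Row sums equal to 1 spread [ln b_j] over [k], so that the comparison becomes termwise in [j] and
   [k]. *)
rewrite -[X in _ <= X + _]mulr1 -(w_row j) mulr_sumr -!big_split.
apply: ler_sum => k _ /=.
rewrite -mulrDr [X in _ <= X + _]mulrC -mulrDr ler_wpM2l //.
case: ifPn => [_ | ]; first exact: gain_bound.
by rewrite inE negbK subr_eq0 => /eqP ->; rewrite ln1 divr1 addr0 add0r.
Qed.

(** With [m_i = max 1 l_i], the determinant of [B] is the product of the [m_i], and the trace falls
    below [\tr A] by the sum of [l_i (m_i - 1) / m_i]. Each such term equals [m_i - 1], because
    either [m_i = l_i] or [m_i = 1]. *)
Lemma low_rank_loglik_attained p r (A : 'M[R]_p) (Z : 'M[R]_(p, r)) :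
  A^T = A ->
  A *m Z = Z *m diag_mx (\row_(i < r) eigval A i) ->
  Z^T *m Z = diag_mx (\row_(i < r) (Num.max 1 (eigval A i) - 1)) ->
  let B := 1%:M + Z *m Z^T in
  ln (\det B) + \tr (invmx B *m A) = \tr A + \sum_(i < r) gain (eigval A i).
Proof.
move=> symA AZ ZZ B.
pose l := \row_(i < r) eigval A i; pose m : 'rV[R]_r := \row_i Num.max 1 (l 0 i).
have m_gt0 i : 0 < m 0 i by rewrite mxE lt_max ltr01.
have mE : 1%:M + Z^T *m Z = diag_mx m.
  rewrite ZZ -diag_const_mx -linearD; congr diag_mx; apply/rowP => i; rewrite !mxE.
  by rewrite addrC subrK.
pose E := diag_mx (\row_i (m 0 i)^-1).
have mEE : diag_mx m *m E = 1%:M by apply: diag_mx_inv => i; rewrite gt_eqF.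
(* Woodbury: only the diagonal [r] by [r] matrix [1 + Z^T Z] has to be inverted. *)
have invB : invmx B = 1%:M - Z *m E *m Z^T.
  apply: invmx_uniq; rewrite /B mulmxBr mulmxDl mul1mx mulmx1.
  have -> : (1%:M + Z *m Z^T) *m (Z *m E *m Z^T) = Z *m Z^T; last by rewrite addrK.
  have -> : (1%:M + Z *m Z^T) *m (Z *m E *m Z^T) = Z *m ((1%:M + Z^T *m Z) *m E) *m Z^T.
    by rewrite !mulmxDl !mul1mx mulmxDr mulmxDl !mulmxA.
  by rewrite mE mEE mulmx1.
have ZA : Z^T *m A = diag_mx l *m Z^T.
  by rewrite -[LHS]trmxK trmx_mul trmxK symA AZ trmx_mul tr_diag_mx.
rewrite {1}/B det_1DmulC mE det_diag ln_prod //.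
rewrite invB mulmxBl mul1mx linearB /= -!mulmxA ZA mxtrace_mulC -!mulmxA ZZ.
rewrite addrCA; congr (_ + _); rewrite mulmx_diag mxtrace_diag_mul -sumrB.
apply: eq_bigr => i _; rewrite !mxE eqxx mulr1n /gain -addrA; congr (_ + _).
rewrite maxEle; case: leP => [l1 | _]; last by rewrite !subrr mulr0 mulr0 oppr0 addNr.
by rewrite mulKf ?gt_eqF ?(lt_le_trans ltr01) // opprB addrC.
Qed.

End Likelihood.

(** * Square roots of positive diagonal matrices *)

Section SquareRoot.
Context {R : realType}.

Lemma quad_diagE n (d : 'rV[R]_n) (x : 'cV[R]_n) :
  (x^T *m diag_mx d *m x) 0 0 = \sum_i d 0 i * x i 0 ^+ 2.
Proof.
rewrite mxE; apply: eq_bigr => i _; rewrite mul_mx_diag !mxE expr2 mulrA.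
by rewrite (mulrC (x i 0)).
Qed.

Lemma sqrtmx_diag n (d : 'rV[R]_n) : (forall i, 0 < d 0 i) ->
  sqrtmx (diag_mx d) = diag_mx (\row_i Num.sqrt (d 0 i)).
Proof.
move=> d_gt0; set e := \row_i _.
have e_gt0 i : 0 < e 0 i by rewrite mxE sqrtr_gt0.
have eE i : e 0 i ^+ 2 = d 0 i by rewrite mxE sqr_sqrtr // ltW.
have ee : diag_mx e *m diag_mx e = diag_mx d.
  by rewrite mulmx_diag; congr diag_mx; apply/rowP => i; rewrite mxE -expr2.
clearbody e.
apply: xget_unique => /=.
  split=> //; split; first exact: tr_diag_mx.
  by move=> x; rewrite quad_diagE sumr_ge0 // => i _; rewrite mulr_ge0 ?sqr_ge0 // ltW.
move=> B [[symB B_ge0] BB].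
(* [B] commutes with its square [d], so [B i j = 0] unless [d] agrees at [i] and [j]; there [e]
   agrees too, being positive. *)
have comm : diag_mx e *m B = B *m diag_mx e.
  have /matrixP dB : diag_mx d *m B = B *m diag_mx d by rewrite -BB mulmxA.
  apply/matrixP => i j; have := dB i j.
  rewrite !mul_diag_mx !mul_mx_diag !mxE -!eE => /eqP.
  rewrite (mulrC (B i j)) -subr_eq0 -mulrBl mulf_eq0 subr_eq0 => /orP [].
    by rewrite eqrXn2 ?ltW // => /eqP ->; rewrite mulrC.
  by move=> /eqP ->; rewrite mulr0 mul0r.
(* [B] commutes with [e = d^(1/2)], so [(B - e)(B + e) = 0], and [B + e] is
   positive definite. *)
have prod0 : (B - diag_mx e) *m (B + diag_mx e) = 0.
  by rewrite mulmxBl !mulmxDr BB ee comm addrC (addrC (diag_mx d)) addNr.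
have unitBe : B + diag_mx e \in unitmx.
  (* For [u] in the kernel, [u B u^T] and [u e u^T] are nonnegative with sum 0; the second one
     vanishes only at [u = 0]. *)
  rewrite -row_free_unit -kermx_eq0; apply/eqP/row_matrixP => i.
  set u := row i _; have uk : u *m (B + diag_mx e) = 0.
    by rewrite -row_mul mulmx_ker row0.
  rewrite row0; have := B_ge0 u^T; rewrite trmxK.
  have : (u *m (B + diag_mx e) *m u^T) 0 0 = 0 by rewrite uk mul0mx mxE.
  rewrite mulmxDr mulmxDl mxE.
  have := quad_diagE _ e u^T; rewrite trmxK => ->.
  have s_ge0 j : 0 <= e 0 j * u^T j 0 ^+ 2 by rewrite mulr_ge0 ?sqr_ge0 // ltW.
  move=> /eqP /[swap] Bu; rewrite paddr_eq0 //; last by rewrite sumr_ge0.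
  move=> /andP [_]; rewrite psumr_eq0 // => /allP /= u0.
  apply/rowP => j; have := u0 j (mem_index_enum j).
  by rewrite mulf_eq0 gt_eqF //= sqrf_eq0 !mxE => /eqP.
apply/eqP; rewrite -subr_eq0; apply/eqP.
by rewrite -[LHS](mulmxK unitBe) prod0 mul0mx.
Qed.

Lemma invmx_diag n (d : 'rV[R]_n) : (forall i, 0 < d 0 i) ->
  invmx (diag_mx d) = diag_mx (\row_i (d 0 i)^-1).
Proof. by move=> d0; apply: invmx_uniq; apply: diag_mx_inv => i; rewrite gt_eqF. Qed.

End SquareRoot.

(** * Minimizing over [L] for a fixed feasible [Psi] *)

Lemma col_mulmx {R : pzSemiRingType} m n q (A : 'M[R]_(m, n)) (B : 'M[R]_(n, q)) j :
  col j (A *m B) = A *m col j B.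
Proof. by apply/colP => i; rewrite !mxE; apply: eq_bigr => k _; rewrite mxE. Qed.

Section Reduction.
Context {R : realType} (p r : nat) (eps : R) (S : 'M[R]_p).
Hypotheses (rp : (0 < r <= p)%N) (eps_gt0 : 0 < eps) (symS : S^T = S).
Variable Psi : 'M[R]_p.
Hypothesis feasPsi : diag_feasible eps Psi.

Let D := sqrtmx Psi.
Let C := sqrtmx (invmx Psi).
Let A := Sstar S Psi.

Lemma diag_feasible_gt0 : exists2 d : 'rV[R]_p, Psi = diag_mx d & forall i, 0 < d 0 i.
Proof.
have [/is_diag_mxP diagPsi [_ Psi_ge]] := feasPsi.
have PsiE : Psi = diag_mx (\row_i Psi i i).
  apply/matrixP => i j; rewrite !mxE; have [<-|ij] := eqVneq i j; first by rewrite mulr1n.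
  by rewrite diagPsi.
exists (\row_i Psi i i) => // i; rewrite mxE.
(* Testing the Loewner bound on a basis vector gives [Psi i i >= eps]. *)
have := Psi_ge (delta_mx i 0).
rewrite trmx_delta -rowE -colE !mxE eqxx mulr1n subr_ge0.
exact: lt_le_trans.
Qed.

Lemma sqrtmx_factors : [/\ D^T = D, C^T = C, D *m C = 1%:M, D *m D = Psi & 0 < \det Psi].
Proof.
have [d PsiE d_gt0] := diag_feasible_gt0.
have s_gt0 i : 0 < Num.sqrt (d 0 i) by rewrite sqrtr_gt0.
rewrite /D /C PsiE invmx_diag // !sqrtmx_diag //; last by move=> i; rewrite mxE invr_gt0.
rewrite !tr_diag_mx det_diag prodr_gt0 //; split=> //.
  rewrite mulmx_diag -diag_const_mx; congr diag_mx; apply/rowP => i.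
  by rewrite !mxE sqrtrV ?ltW // divff // gt_eqF.
by rewrite mulmx_diag; congr diag_mx; apply/rowP => i; rewrite !mxE -expr2 sqr_sqrtr // ltW.
Qed.

Lemma Sstar_sym : A^T = A.
Proof.
by have [_ symC _ _ _] := sqrtmx_factors; rewrite /A /Sstar -/C !trmx_mul symC symS mulmxA.
Qed.

(** The change of variable [M = C L] turns [Sigma] into [D B D]; cycling the outer [C] around the
    trace makes [Sstar] appear. *)
Lemma negloglikE (L : 'M[R]_(p, r)) (B := 1%:M + (C *m L) *m (C *m L)^T) :
  negloglik S (Psi + L *m L^T) = ln (\det Psi) + (ln (\det B) + \tr (invmx B *m A)).
Proof.
have [symD symC DC DD det_gt0] := sqrtmx_factors.
have CD := mulmx1C DC.
have [B_gt0 _] := low_rank_loglik_ge _ _ A (C *m L) Sstar_sym rp.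
rewrite -/B in B_gt0.
have SigmaE : Psi + L *m L^T = D *m B *m D.
  rewrite /B mulmxDr mulmxDl mulmx1 DD; congr (_ + _).
  by rewrite trmx_mul symC !mulmxA DC mul1mx -!mulmxA CD mulmx1.
have unitB : B \in unitmx by rewrite unitmxE unitfE gt_eqF.
have invE : invmx (Psi + L *m L^T) = C *m invmx B *m C.
  apply: invmx_uniq; rewrite SigmaE !mulmxA -(mulmxA _ D C) DC mulmx1.
  by rewrite -(mulmxA D B) mulmxV // mulmx1.
have detE : \det (invmx (Psi + L *m L^T)) = (\det Psi * \det B)^-1.
  by rewrite det_inv SigmaE -DD !det_mulmx mulrAC.
rewrite /negloglik detE lnV ?posrE ?mulr_gt0 // opprK lnM ?posrE //.
by rewrite -addrA invE -!mulmxA mxtrace_mulC /A /Sstar -/C !mulmxA.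
Qed.

Lemma objQE : objQ r S Psi = ln (\det Psi) + (\tr A + \sum_(i < r) gain (eigval A i)).
Proof. by rewrite /objQ addrA. Qed.

Lemma objQ_le_negloglik (L : 'M[R]_(p, r)) : objQ r S Psi <= negloglik S (Psi + L *m L^T).
Proof.
rewrite negloglikE objQE lerD2l.
by have [] := low_rank_loglik_ge _ _ A (C *m L) Sstar_sym rp.
Qed.

(** Since [C D = 1], the matrix [M] is [Z] itself. What remains is that [Z^T Z] is diagonal: columns
    for equal eigenvalues are orthogonal by assumption, the others by the symmetry of [A]. *)
Lemma negloglik_top_eigenvectors (Z : 'M[R]_(p, r)) :
  top_eigenvectors A Z ->
  (forall i : 'I_r, enorm (col i Z) ^+ 2 = Num.max 1 (eigval A i) - 1) ->
  negloglik S (Psi + (D *m Z) *m (D *m Z)^T) = objQ r S Psi.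
Proof.
move=> [AZ orthZ] normZ.
have [_ _ /mulmx1C CD _ _] := sqrtmx_factors.
rewrite negloglikE objQE mulmxA CD mul1mx low_rank_loglik_attained ?Sstar_sym //.
  apply/matrixP => i j; have /colP /(_ i) := AZ j.
  by rewrite -col_mulmx mul_mx_diag !mxE mulrC.
have dotE i j : (Z^T *m Z) i j = ((col i Z)^T *m col j Z) 0 0.
  by rewrite !mxE; apply: eq_bigr => k _; rewrite !mxE.
apply/matrixP => i j; rewrite dotE.
have [<- | ij] := eqVneq i j.
  have := normZ i; rewrite sqr_sqrtr; last by rewrite sumr_ge0 // => k _; rewrite sqr_ge0.
  rewrite !mxE eqxx mulr1n => <-.
  by apply: eq_bigr => k _; rewrite !mxE expr2.
rewrite [RHS]mxE (negPf ij) mulr0n.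
have [eq_ij | neq_ij] := eqVneq (eigval A i) (eigval A j); first exact: orthZ.
have : (eigval A i - eigval A j) * ((col i Z)^T *m col j Z) 0 0 = 0.
  have E : (A *m col i Z)^T *m col j Z = (col i Z)^T *m (A *m col j Z).
    by rewrite trmx_mul Sstar_sym mulmxA.
  move: E; rewrite !AZ linearZ /= -scalemxAl -scalemxAr => /matrixP /(_ 0 0).
  by rewrite mulrBl mxE [in RHS]mxE => ->; rewrite subrr.
by move=> /eqP; rewrite mulf_eq0 subr_eq0 (negPf neq_ij) => /eqP.
Qed.

Lemma top_eigenvectors_exist : exists Z : 'M[R]_(p, r), top_eigenvectors A Z /\
  forall i : 'I_r, enorm (col i Z) ^+ 2 = Num.max 1 (eigval A i) - 1.
Proof.
have [_ _ [U UU AE]] := eigvalsP _ A Sstar_sym.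
have /andP [_ r_le_p] := rp.
pose k (i : 'I_r) := widen_ord r_le_p i.
pose s (i : 'I_r) := Num.sqrt (Num.max 1 (eigval A i) - 1).
(* The first [r] columns of [U] belong to the [r] largest eigenvalues; [s] rescales them from norm 1
   to the required norm. *)
pose Z := \matrix_(i, j) (s j * U i (k j)) : 'M[R]_(p, r).
have colZ j : col j Z = s j *: col (k j) U by apply/colP => i; rewrite !mxE.
have dotZ i j : ((col i Z)^T *m col j Z) 0 0 = s i * s j *+ (i == j).
  rewrite !colZ -scalemxAr [(_ *: _)^T]linearZ /= -scalemxAl scalerA mulrC mxE.
  move/matrixP: UU => /(_ (k i) (k j)); rewrite !mxE -val_eqE /= val_eqE => UUij.
  rewrite -mulr_natr -UUij; congr (_ * _).
  by apply: eq_bigr => l _; rewrite !mxE.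
exists Z; split; first split.
- move=> j; rewrite colZ -scalemxAr scalerA mulrC -scalerA; congr (_ *: _).
  have AU : A *m U = U *m diag_mx (\row_i eigval A i).
    by rewrite {1}AE -!mulmxA UU mulmx1.
  rewrite -col_mulmx AU; apply/colP => i.
  by rewrite mxE mul_mx_diag !mxE mulrC.
- by move=> i j /negPf ij _; rewrite dotZ ij.
- move=> i; rewrite sqr_sqrtr; last by rewrite sumr_ge0 // => l _; rewrite sqr_ge0.
  have := dotZ i i; rewrite eqxx mulr1n -expr2 sqr_sqrtr ?subr_ge0 ?le_max ?lexx // => <-.
  by rewrite mxE; apply: eq_bigr => l _; rewrite !mxE expr2.
Qed.

Lemma negloglik_attains_objQ :
  exists L : 'M[R]_(p, r), negloglik S (Psi + L *m L^T) = objQ r S Psi.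
Proof.
have [Z [topZ normZ]] := top_eigenvectors_exist.
by exists (D *m Z); apply: negloglik_top_eigenvectors.
Qed.

End Reduction.

(** * From a fixed [Psi] to the equivalence of both problems *)

Theorem proposition2 (R : realType) (p r : nat) (eps : R) (S : 'M[R]_p)
    (hp : (1 <= p)%N) (hr1 : (1 <= r)%N) (hrp : (r <= p)%N) (heps : 0 < eps)
    (hS : psdmx S) (hSdiag : forall i : 'I_p, 0 < S i i) :
  (optimal_value (@feasP R p r eps) (objP S)
     = optimal_value (diag_feasible eps) (objQ r S) /\
   forall Psi : 'M[R]_p, diag_feasible eps Psi ->
     (minimizerQ r eps S Psi <->
      exists L : 'M[R]_(p, r), minimizerP eps S Psi L)) /\
  (forall (Psi : 'M[R]_p) (Z : 'M[R]_(p, r)),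
     minimizerQ r eps S Psi ->
     top_eigenvectors (Sstar S Psi) Z ->
     (forall i : 'I_r,
        enorm (col i Z) ^+ 2 = Num.max 1 (eigval (Sstar S Psi) i) - 1) ->
     minimizerP eps S Psi (sqrtmx Psi *m Z)).
Proof.
have rp : (0 < r <= p)%N by rewrite hr1.
have [symS _] := hS.
(* [lower] and [attain] together say that [objQ] at [Psi] is the minimum of the likelihood objective
   over [L]; the rest is formal. *)
have lower Psi (L : 'M[R]_(p, r)) : diag_feasible eps Psi ->
    objQ r S Psi <= negloglik S (Psi + L *m L^T).
  by move=> feasPsi; exact: (objQ_le_negloglik p r eps S rp heps symS Psi feasPsi L).
have attain Psi : diag_feasible eps Psi ->
    exists L : 'M[R]_(p, r), negloglik S (Psi + L *m L^T) = objQ r S Psi.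
  by move=> feasPsi; exact: (negloglik_attains_objQ p r eps S rp heps symS Psi feasPsi).
(* Serves both (b) and the forward direction of the equivalence in (a). *)
have minQP Psi (L : 'M[R]_(p, r)) : minimizerQ r eps S Psi ->
    negloglik S (Psi + L *m L^T) = objQ r S Psi -> minimizerP eps S Psi L.
  move=> [feasPsi minPsi] PsiL; split=> // -[[Psi' L'] Sigma'] /= [feasPsi' ->].
  by rewrite /objP /= PsiL; apply: le_trans (minPsi _ feasPsi') (lower _ _ feasPsi').
split; last first.
  move=> Psi Z minPsi topZ normZ; have [feasPsi _] := minPsi.
  apply: (minQP _ _ minPsi).
  exact: (negloglik_top_eigenvectors p r eps S rp heps symS Psi feasPsi Z topZ normZ).
split.
  apply/eqP; rewrite eq_le; apply/andP; split.
  - apply: le_ereal_inf_tmp => _ /= [Psi feasPsi <-].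
    have [L PsiL] := attain _ feasPsi.
    apply: ge_ereal_inf; exists (objQ r S Psi)%:E => //.
    by exists (Psi, L, Psi + L *m L^T) => //; rewrite -PsiL.
  - apply: le_ereal_inf_tmp => _ /= [[[Psi L] Sigma] [feasPsi ->] <-].
    apply: ge_ereal_inf; exists (objQ r S Psi)%:E; first by exists Psi.
    by rewrite lee_fin lower.
move=> Psi feasPsi; split=> [minPsi | [L [_ minL]]].
  by have [L PsiL] := attain _ feasPsi; exists L; apply: minQP.
(* The competitor [Psi'] is paired with an [L'] that attains its value of [objQ], so the minimality
   of [(Psi, L)] applies. *)
split=> // Psi' feasPsi'; have [L' <-] := attain _ feasPsi'.
apply: le_trans (lower _ L feasPsi) _.
exact: (minL (Psi', L', Psi' + L' *m L'^T)).
Qed.
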